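(* Let $m$ and $n$ be positive integers. The complete bipartite graph $K_{m,n}$ can be expressed as the matrix product of two graphs (that is, $K_{m,n}$ is an MPF graph) if and only if $m$ and $n$ are both even.
   Context: All graphs are finite. A simple graph is an undirected graph without loops or multiple edges. A labeling of a graph on $N$ vertices is a bijection from its vertex set to an $N$-element index set such as $\{1,\ldots,N\}$; it determines the $N\times N$ adjacency matrix $A(\cdot)$ of the graph. A simple graph $X$ on $N$ vertices can be expressed as the matrix product of two graphs (is matrix product factorizable, or an MPF graph) if there exist simple graphs $G$ and $H$ on $N$ vertices and labelings of $G$, $H$ and $X$ such that, with respect to these labelings, $A(G)A(H)=A(X)$. *)

(* Defs.v *)
From HB Require Import structures.
From mathcomp Require Import all_boot all_order all_algebra.

Set Implicit Arguments.
Unset Strict Implicit.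
Unset Printing Implicit Defensive.

Import GRing.Theory.

Local Open Scope ring_scope.

Record sgraph := SGraph {
  vertex :> finType;
  adj : rel vertex;
  adj_sym : symmetric adj;
  adj_irr : irreflexive adj
}.

(* A labeling is a bijection f from the vertices onto the index type 'I_N.
   The entry (i, j) is 1 when the vertices labelled i and j are adjacent;
   writing it with existentials avoids naming the inverse of f. *)
Definition adjmx (N : nat) (X : sgraph) (f : X -> 'I_N) : 'M[int]_N :=
  \matrix_(i, j)
    ([exists x, exists y, [&& f x == i, f y == j & adj x y]] : nat)%:R.

Definition mpf (X : sgraph) : Prop :=
  exists (G H : sgraph)
         (g : G -> 'I_#|X|) (h : H -> 'I_#|X|) (f : X -> 'I_#|X|),
    [/\ bijective g, bijective h, bijective f
      & adjmx g *m adjmx h = adjmx f].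

Definition Kmn_adj (m n : nat) : rel ('I_m + 'I_n) := fun u v =>
  match u, v with
  | inl _, inr _ | inr _, inl _ => true
  | _, _ => false
  end.

Lemma Kmn_adj_sym (m n : nat) : symmetric (@Kmn_adj m n).
Proof. by case=> [?|?] [?|?]. Qed.

Lemma Kmn_adj_irr (m n : nat) : irreflexive (@Kmn_adj m n).
Proof. by case. Qed.

Definition Kmn (m n : nat) : sgraph :=
  SGraph (@Kmn_adj_sym m n) (@Kmn_adj_irr m n).

(* Main.v *)
Require Import Defs.
From mathcomp Require Import all_boot all_order all_algebra.

(** Write [a] and [b] for the adjacency relations of the two factors [G] and
    [H], carried over to the common index set, and suppose that their matrix
    product is the adjacency matrix of a complete bipartite graph, whose edges
    join the indices lying on different sides.  An entry of the product counts
    the paths made of an [a]-edge and then a [b]-edge, so at every vertex each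
    [a]-neighbour is across from each [b]-neighbour
    ([product_neighbors_opposite]).  Transposing shows that the two factors
    commute ([product_relC]), so [a] and [b] play symmetric roles.

    Necessity is a parity argument.  Suppose that all [b]-neighbours of [k] are
    across from [k].  Each of them is then joined to [k] by exactly one path,
    hence has exactly one [a]-neighbour among the [b]-neighbours of [k]: on that
    set [a] is a perfect matching, so the [b]-degree of [k] is even
    ([crossing_degree_even]).  Now take any vertex [i].  Either its
    [a]-neighbours are all on its own side, or its [b]-neighbours are, since an
    [a]-neighbour across from [i] is across from every [b]-neighbour.  In the
    first case each [a]-neighbour [k] of [i] has the [a]-neighbour [i] on its own
    side, so the [b]-neighbours of [k] are all across from [k] and its [b]-degree
    is even; the degree of [i] in the product, which is the sum of these
    [b]-degrees, is even.  The second case is the first with the factors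
    exchanged.  Thus every degree of [K_{m,n}] is even
    ([complete_bipartite_product_degree_even]), and these degrees are [m] and
    [n].

    For sufficiency, let [G] be a perfect matching inside each part and [H] be
    [K_{m,n}] itself: moving along the matching does not change the part, so
    multiplying by the matching fixes the adjacency matrix of [K_{m,n}]. *)

Set Implicit Arguments.
Unset Strict Implicit.
Unset Printing Implicit Defensive.

Import GRing.Theory.

(** Handshake lemma for the subgraph induced by [P]: the sum counts each edge
    once in each direction, and ranking the vertices tells the two directions
    apart. *)
Lemma induced_degree_sum_even (T : finType) (P : pred T) (e : rel T) :
    symmetric e -> irreflexive e ->
  ~~ odd (\sum_(x | P x) \sum_(y | P y) e x y).
Proof.
move=> e_sym e_irr; pose lt (x y : T) := enum_rank x < enum_rank y.
have split_e x y : (e x y : nat) = (e x y && lt x y) + (e x y && lt y x).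
  rewrite /lt; case: ltngtP => [||/val_inj/enum_rank_inj->].
  - by rewrite andbT andbF addn0.
  - by rewrite andbT andbF.
  - by rewrite e_irr.
under eq_bigr => x _.
  under eq_bigr => y _ do rewrite split_e.
  rewrite big_split /=; over.
rewrite big_split /= [X in _ + X]exchange_big /=.
under [X in _ + X]eq_bigr => x _ do under eq_bigr => y _ do rewrite e_sym.
by rewrite addnn odd_double.
Qed.

(** The transpose of a product of symmetric matrices is the product in the other
    order, so if the product is symmetric the factors commute. *)
Lemma product_relC (T : finType) (a b c : rel T) :
    symmetric a -> symmetric b -> symmetric c ->
    (forall i j, \sum_k a i k * b k j = c i j) ->
  forall i j, \sum_k b i k * a k j = c i j.
Proof.
move=> a_sym b_sym c_sym abE i j; rewrite c_sym -abE.
by apply: eq_bigr => k _; rewrite mulnC a_sym b_sym.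
Qed.

Section CompleteBipartiteProduct.

Variables (T : finType) (side : pred T).

Definition opposite : rel T := fun i j => side i != side j.

Lemma opposite_sym : symmetric opposite.
Proof. by move=> i j; rewrite /opposite eq_sym. Qed.

Lemma product_neighbors_opposite (a b : rel T) :
    symmetric a -> (forall i j, \sum_k a i k * b k j = opposite i j) ->
  forall k x y, a k x -> b k y -> opposite x y.
Proof.
move=> a_sym abE k x y akx bky; have := abE x y.
by rewrite (bigD1 k) //= a_sym akx bky; case: opposite.
Qed.

(** The [b]-neighbours of [k] induce a perfect matching in [a], and a perfect
    matching covers an even number of vertices. *)
Lemma crossing_degree_even (a b : rel T) (k : T) :
    symmetric a -> irreflexive a -> symmetric b ->
    (forall i j, \sum_k a i k * b k j = opposite i j) ->
    (forall x, b k x -> opposite x k) ->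
  ~~ odd (\sum_x b k x).
Proof.
move=> a_sym a_irr b_sym abE b_cross.
have := induced_degree_sum_even (b k) a_sym a_irr.
suff -> : \sum_(x | b k x) \sum_(y | b k y) a x y = \sum_x b k x by [].
rewrite [RHS](bigID (b k)) /= [X in _ = _ + X]big1 => [|x /negbTE-> //].
rewrite addn0; apply: eq_bigr => x bkx; rewrite bkx.
have := abE x k; rewrite (b_cross _ bkx) => <-.
rewrite big_mkcond /=; apply: eq_bigr => y _.
by rewrite b_sym; case: (b y k); rewrite ?muln1 ?muln0.
Qed.

(** An [a]-neighbour [k] of [i] on the side of [i] sees [i] as an [a]-neighbour
    on its own side, which forces its [b]-neighbours to the other side. *)
Lemma degree_even_of_same_side (a b : rel T) (i : T) :
    symmetric a -> irreflexive a -> symmetric b ->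
    (forall i j, \sum_k a i k * b k j = opposite i j) ->
    (forall k, a i k -> ~~ opposite i k) ->
  ~~ odd (\sum_j opposite i j).
Proof.
move=> a_sym a_irr b_sym abE a_same.
under eq_bigr => j _ do rewrite -abE.
rewrite exchange_big /=; under eq_bigr => k _ do rewrite -big_distrr /=.
apply: (big_ind (fun s => ~~ odd s)) => // [s t | k _].
  by rewrite oddD => /negbTE-> /negbTE->.
case aik: (a i k); rewrite ?mul0n // mul1n.
apply: (crossing_degree_even a_sym a_irr b_sym abE) => x bkx.
have aki : a k i by rewrite a_sym.
have := product_neighbors_opposite a_sym abE aki bkx.
have := a_same k aik; rewrite /opposite negbK => /eqP->.
by rewrite eq_sym.
Qed.

Lemma complete_bipartite_product_degree_even (a b : rel T) (i : T) :
    symmetric a -> irreflexive a -> symmetric b -> irreflexive b ->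
    (forall i j, \sum_k a i k * b k j = opposite i j) ->
  ~~ odd (\sum_j opposite i j).
Proof.
move=> a_sym a_irr b_sym b_irr abE.
have [a_same | ] := boolP [forall k, a i k ==> ~~ opposite i k].
  apply: (degree_even_of_same_side a_sym a_irr b_sym abE) => k.
  exact/implyP/(forallP a_same).
rewrite negb_forall => /existsP[x]; rewrite negb_imply negbK => /andP[aix ix_opp].
have baE := product_relC a_sym b_sym opposite_sym abE.
apply: (degree_even_of_same_side b_sym b_irr a_sym baE) => k bik.
have := product_neighbors_opposite a_sym abE aix bik.
by move: ix_opp; rewrite /opposite; do 3!case: side.
Qed.

End CompleteBipartiteProduct.

Lemma adjmxE (N : nat) (X : sgraph) (f : X -> 'I_N) (f' : 'I_N -> X) i j :
  cancel f f' -> cancel f' f -> adjmx f i j = (adj (f' i) (f' j) : nat)%:R%R.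
Proof.
move=> fK f'K; rewrite mxE; congr ((nat_of_bool _)%:R)%R.
apply/existsP/idP => [[x /existsP[y /and3P[/eqP<- /eqP<-]]] | e_ij].
  by rewrite !fK.
by exists (f' i); apply/existsP; exists (f' j); rewrite !f'K !eqxx.
Qed.

Definition Kmn_side (m n : nat) (u : Kmn m n) : bool := is_inl u.

Lemma Kmn_adjE (m n : nat) (u v : Kmn m n) :
  adj u v = opposite (@Kmn_side m n) u v.
Proof. by case: u v => [?|?] [?|?]. Qed.

Lemma Kmn_degree (m n : nat) (u : Kmn m n) :
  \sum_v adj u v = if Kmn_side u then n else m.
Proof.
rewrite big_sumType /=; case: u => i /=;
  by rewrite !sum_nat_const !card_ord muln0 muln1 ?addn0.
Qed.

Lemma mpf_Kmn_degree_even (m n : nat) (u : Kmn m n) :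
  mpf (Kmn m n) -> ~~ odd (\sum_v adj u v).
Proof.
case=> G [H] [g] [h] [f] [[g' gK g'K] [h' hK h'K] [f' fK f'K] ghE].
pose a i j := adj (g' i) (g' j); pose b i j := adj (h' i) (h' j).
pose side i := Kmn_side (f' i).
have abE i j : \sum_k a i k * b k j = opposite side i j.
  have /matrixP/(_ i j) := ghE; rewrite mxE (adjmxE _ _ fK f'K) Kmn_adjE => ghij.
  apply/eqP; rewrite -(Num.Theory.eqr_nat int) -[X in _ == X]ghij natr_sum.
  apply/eqP/eq_bigr => k _.
  by rewrite (adjmxE _ _ gK g'K) (adjmxE _ _ hK h'K) natrM.
have := complete_bipartite_product_degree_even (f u)
  (fun i j => adj_sym _ _) (fun i => adj_irr _)
  (fun i j => adj_sym _ _) (fun i => adj_irr _) abE.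
suff -> : \sum_v adj u v = \sum_j opposite side (f u) j by [].
rewrite (reindex f'); last by exists f => i _.
by apply: eq_bigr => j _; rewrite Kmn_adjE /opposite /side fK.
Qed.

Lemma rev_ord_neq (n : nat) (i : 'I_n) : ~~ odd n -> rev_ord i != i.
Proof.
apply: contra => /eqP/(congr1 val) /= iE.
by rewrite -(subnK (ltn_ord i)) iE addnS addnn /= odd_double.
Qed.

(** Reversing each part is a fixed-point free involution exactly when both
    parts are even; its orbits are the edges of the matching. *)
Definition Kmn_rev (m n : nat) (u : Kmn m n) : Kmn m n :=
  match u with inl i => inl (rev_ord i) | inr j => inr (rev_ord j) end.

Lemma Kmn_revK (m n : nat) : involutive (@Kmn_rev m n).
Proof. by case=> i /=; rewrite rev_ordK. Qed.

Definition matching_adj (m n : nat) : rel (Kmn m n) :=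
  fun u v => v == Kmn_rev u.

Lemma matching_adj_sym (m n : nat) : symmetric (@matching_adj m n).
Proof.
by move=> u v; rewrite /matching_adj -(can_eq (@Kmn_revK m n)) Kmn_revK eq_sym.
Qed.

Lemma matching_adj_irr (m n : nat) :
  ~~ odd m -> ~~ odd n -> irreflexive (@matching_adj m n).
Proof.
move=> m_even n_even [] i; rewrite /matching_adj /= eq_sym;
  by apply/negbTE; apply: contra (rev_ord_neq i _) => // /eqP[].
Qed.

Lemma mpf_Kmn_even (m n : nat) : ~~ odd m -> ~~ odd n -> mpf (Kmn m n).
Proof.
move=> m_even n_even.
pose G := SGraph (@matching_adj_sym m n) (matching_adj_irr m_even n_even).
have rK := @enum_rankK (Kmn m n); have vK := @enum_valK (Kmn m n).
have r_bij : bijective (@enum_rank (Kmn m n)) by exists enum_val.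
exists G, (Kmn m n), enum_rank, enum_rank, enum_rank; split=> //.
apply/matrixP => i j; rewrite mxE (adjmxE _ _ rK vK).
under eq_bigr => k _.
  rewrite (@adjmxE _ G _ _ _ _ rK vK) (adjmxE _ _ rK vK) -natrM; over.
rewrite -natr_sum /=; congr (_%:R)%R.
(* The only contributing middle vertex is the partner of the row vertex. *)
rewrite (bigD1 (enum_rank (Kmn_rev (enum_val i)))) //= big1 => [|k k_neq].
  by rewrite enum_rankK /matching_adj eqxx mul1n addn0; case: (enum_val i).
rewrite /matching_adj; case: eqP => // kE.
by rewrite -kE enum_valK eqxx in k_neq.
Qed.

Theorem theorem1p4 (m n : nat) (m_gt0 : 0 < m) (n_gt0 : 0 < n) :
  mpf (Kmn m n) <-> ~~ odd m /\ ~~ odd n.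
Proof.
split=> [K_mpf | [m_even n_even]]; last exact: mpf_Kmn_even.
have K_even u := mpf_Kmn_degree_even u K_mpf.
split; [have := K_even (inr (Ordinal n_gt0)) | have := K_even (inl (Ordinal m_gt0))];
  by rewrite Kmn_degree.
Qed.
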